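(* Let $F$ be a field, let $n,N$ be positive integers, and let $(A_1,A_2,\dots,A_N)$ be an $N$-tuple of $n\times n$ matrices over $F$. If $N\ge n+1$, then the following relations hold: (1) $$\sum_{k=0}^{N}(-1)^k\sum_{\substack{\sigma\subset[N]\\ |\sigma|=k}}\det\Bigl(\sum_{i\in\sigma}A_i\Bigr)=0 ;$$ (2) $$\sum_{k=0}^{N}(-1)^k\sum_{\substack{\sigma\subset[N]\\ |\sigma|=k}}\operatorname{per}\Bigl(\sum_{i\in\sigma}A_i\Bigr)=0 .$$
   Context: Here $[N]=\{1,2,\dots,N\}$, the inner sums run over all subsets $\sigma$ of $[N]$ of cardinality $k$, and the sum over the empty set is the zero matrix. For an $n\times n$ matrix $M=(m_{ij})$, the permanent is $\operatorname{per}(M)=\sum_{\pi\in S_n}\prod_{i=1}^n m_{i,\pi(i)}$, where $S_n$ is the symmetric group on $\{1,\dots,n\}$. *)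

(* Defs.v *)
From HB Require Import structures.
From mathcomp Require Import all_boot all_order all_fingroup all_algebra.

Set Implicit Arguments.
Unset Strict Implicit.
Unset Printing Implicit Defensive.

Import GRing.Theory.
Local Open Scope ring_scope.

Definition permanent (R : pzSemiRingType) (n : nat) (M : 'M[R]_n) : R :=
  \sum_(s : 'S_n) \prod_(i < n) M i (s i).

(* Main.v *)
(** Expanding each term of the Leibniz formula over the choices [f : [n] -> [N]]
    of a summand in every row, the coefficient of a given choice is the signed
    count of the subsets of [N] containing the image of [f].  As [n < N], some [x]
    lies outside this image, and toggling the membership of [x] is a
    sign-reversing involution on these subsets. *)
Require Import Defs.
From HB Require Import structures.
From mathcomp Require Import all_boot all_order all_fingroup all_algebra.

Set Implicit Arguments.
Unset Strict Implicit.
Unset Printing Implicit Defensive.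

Import GRing.Theory.
Local Open Scope ring_scope.

Lemma sum_signed_eq0 (R : pzRingType) (T : finType) (x : T) (h : {set T} -> R) :
  (forall s : {set T}, x \notin s -> h (x |: s) = h s) ->
  \sum_(s : {set T}) (-1) ^+ #|s| * h s = 0.
Proof.
move=> hx; rewrite (bigID (fun s : {set T} => x \in s)) /=.
(* Each subset containing [x] is [x |: s] for a unique [s] avoiding [x], and its sign is opposite to
   that of [s]. *)
rewrite (reindex_onto (fun s => x |: s) (fun s => s :\ x)) /=; last first.
  by move=> s xs; rewrite setD1K.
rewrite (eq_bigl (fun s : {set T} => x \notin s)); last first.
  move=> s; rewrite setU11 /=; apply/eqP/idP => [<-|xs]; first by rewrite setD11.
  by rewrite setU1K.
rewrite -big_split big1 //= => s xs.
by rewrite cardsU1 xs exprS mulN1r hx // mulNr addNr.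
Qed.

Lemma sum_signed_prod_eq0 (R : comPzRingType) (T : finType) (n : nat)
    (a : 'I_n -> T -> R) :
  (n < #|T|)%N ->
  \sum_(s : {set T}) (-1) ^+ #|s| * \prod_(i < n) \sum_(j in s) a i j = 0.
Proof.
move=> ltnT.
(* Padding the inner sum with zeros off [s] makes its range independent of [s], so the sums over [s]
   and over the choices [f] can be exchanged. *)
under eq_bigr => s _.
  under eq_bigr do rewrite big_mkcond.
  rewrite bigA_distr_bigA mulr_sumr /=; over.
rewrite exchange_big big1 //= => f _.
have [x xf] : exists x, x \notin [set f i | i : 'I_n].
  (* Pigeonhole: if every point were a value of [f], then [#|T| <= n]. *)
  apply/existsP; rewrite -negb_forall; apply: contraL ltnT => /forallP fT.
  rewrite -leqNgt -[leqRHS]card_ord.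
  apply: leq_trans (leq_imset_card f 'I_n).
  by apply: subset_leq_card; apply/subsetP => y _; apply: fT.
apply: (sum_signed_eq0 (x := x)) => s _; apply: eq_bigr => i _.
rewrite in_setU1; case: eqP => // fix_.
by rewrite -fix_ imset_f in xf.
Qed.

(** The weight [w] treats both relations at once: the sign of the permutation gives the determinant,
    the constant 1 the permanent. The cancellation happens separately for each permutation. *)
Lemma sum_signed_immanant_eq0 (R : comPzRingType) (n N : nat) (w : 'S_n -> R)
    (A : 'I_N -> 'M[R]_n) :
  (n < N)%N ->
  \sum_(0 <= k < N.+1)
     (-1) ^+ k * \sum_(sigma : {set 'I_N} | #|sigma| == k)
        \sum_(s : 'S_n) w s * \prod_(i < n) (\sum_(j in sigma) A j) i (s i) = 0.
Proof.
move=> ltnN; rewrite big_mkord.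
have cardN (sigma : {set 'I_N}) : (#|sigma| < N.+1)%N.
  by rewrite ltnS -[leqRHS]card_ord max_card.
transitivity (\sum_(sigma : {set 'I_N}) \sum_(s : 'S_n)
    (-1) ^+ #|sigma| * (w s * \prod_(i < n) (\sum_(j in sigma) A j) i (s i))).
  rewrite [RHS](partition_big (fun sigma => Ordinal (cardN sigma)) xpredT) //=.
  apply: eq_bigr => k _; rewrite mulr_sumr.
  by apply: eq_bigr => sigma /eqP <-; rewrite mulr_sumr.
rewrite exchange_big big1 //= => s _.
under eq_bigr do rewrite mulrCA.
rewrite -mulr_sumr.
under eq_bigr do under eq_bigr do rewrite summxE.
by rewrite sum_signed_prod_eq0 ?card_ord // mulr0.
Qed.

Theorem theorem3p1 (F : fieldType) (n N : nat) (hn : (0 < n)%N) (hN : (0 < N)%N)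
    (A : 'I_N -> 'M[F]_n) (hnN : (n + 1 <= N)%N) :
  (\sum_(0 <= k < N.+1)
      (-1) ^+ k * \sum_(sigma : {set 'I_N} | #|sigma| == k)
                     \det (\sum_(i in sigma) A i) = 0)
  /\
  (\sum_(0 <= k < N.+1)
      (-1) ^+ k * \sum_(sigma : {set 'I_N} | #|sigma| == k)
                     permanent (\sum_(i in sigma) A i) = 0).
Proof.
move: hnN; rewrite addn1 => ltnN; split.
  (* [\det] is the Leibniz sum by definition, so the two sides agree by conversion. *)
  exact: (sum_signed_immanant_eq0 (fun s : 'S_n => (-1) ^+ s)).
rewrite -[RHS](sum_signed_immanant_eq0 (fun=> 1) A ltnN).
apply: eq_bigr => k _; congr (_ * _); apply: eq_bigr => sigma _.
by apply: eq_bigr => s _; rewrite mul1r.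
Qed.
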